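(* Let $\mathcal V$ be a finite vocabulary, $T\ge 1$, $Q_{X_1^T}\in\mathcal P(\mathcal V^T)$, $\alpha\in(0,1)$, $\epsilon\ge 0$, and let $\mathsf D$ be a distortion function on $\mathcal P(\mathcal V^T)$. Let $\beta_1^*(Q_{X_1^T},\alpha,\epsilon)$ be the universally minimum Type-II error, i.e. the optimal value of $$\inf_{\gamma,\,P_{X_1^T,\zeta_1^T}} \beta_1(\gamma,P_{X_1^T,\zeta_1^T})\quad\text{s.t.}\quad \sup_{Q'\in\mathcal P(\mathcal V^T)}\beta_0(\gamma,Q',P_{\zeta_1^T})\le\alpha,\qquad \mathsf D(P_{X_1^T},Q_{X_1^T})\le\epsilon .$$ Then $$\beta_1^*(Q_{X_1^T},\alpha,\epsilon)=\min_{P_{X_1^T}\in\mathcal P(\mathcal V^T):\ \mathsf D(P_{X_1^T},Q_{X_1^T})\le\epsilon}\ \sum_{x_1^T\in\mathcal V^T}\big(P_{X_1^T}(x_1^T)-\alpha\big)_+,$$ and this value is achieved with the watermarked text distribution (the $X_1^T$-marginal of $P_{X_1^T,\zeta_1^T}$) $$P^*_{X_1^T}=\operatorname*{arg\,min}_{P_{X_1^T}:\ \mathsf D(P_{X_1^T},Q_{X_1^T})\le\epsilon}\ \sum_{x_1^T}\big(P_{X_1^T}(x_1^T)-\alpha\big)_+ .$$ Moreover, when $\mathsf D=\mathsf D_{\mathsf{TV}}$ is the total variation distance, if $\sum_{x_1^T}(\alpha-Q_{X_1^T}(x_1^T))_+\ge\epsilon$ then $$\beta_1^*(Q_{X_1^T},\alpha,\epsilon)=\Big(\sum_{x_1^T}\big(Q_{X_1^T}(x_1^T)-\alpha\big)_+-\epsilon\Big)_+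 .$$
   Context: Notation: $(x)_+=\max\{x,0\}$; $\mathcal P(\mathcal X)$ is the set of probability distributions on $\mathcal X$; $X_1^T=(X_1,\dots,X_T)$. A distortion function is a map $\mathsf D:\mathcal P(\mathcal V^T)\times\mathcal P(\mathcal V^T)\to[0,\infty)$ measuring dissimilarity of two distributions (so $\mathsf D(\mu,\mu)=0$), for which the minimum displayed in the claim is attained. $\mathsf D_{\mathsf{TV}}(\mu,\nu)=\frac12\sum_x|\mu(x)-\nu(x)|$. Setting: $Q_{X_1^T}$ is the distribution on $\mathcal V^T$ of length-$T$ token sequences generated by the unwatermarked language model. A watermarking scheme is a joint distribution $P_{X_1^T,\zeta_1^T}$ on $\mathcal V^T\times\mathcal Z^T$, where $\zeta_1^T$ is an auxiliary random sequence taking values in a space $\mathcal Z^T$ (discrete or continuous; its choice is part of the design of the scheme and detector). $P_{X_1^T}$ and $P_{\zeta_1^T}$ denote its marginals. A detector is a (measurable) function $\gamma:\mathcal V^T\times\mathcal Z^T\to\{0,1\}$. For $Q'\in\mathcal P(\mathcal V^T)$ the Type-I error is $\beta_0(\gamma,Q',P_{\zeta_1^T})=\Pr(\gamma(X_1^T,\zeta_1^T)=1)$ under $(X_1^T,\zeta_1^T)\sim Q'\otimes P_{\zeta_1^T}$ (independent), and the Type-II error is $\beta_1(\gamma,P_{X_1^T,\zeta_1^T})=\Pr(\gamma(X_1^T,\zeta_1^T)=0)$ under $(X_1^T,\zeta_1^T)\sim P_{X_1^T,\zeta_1^T}$. *)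

(* Defs.v *)
From HB Require Import structures.
From mathcomp Require Import all_boot all_order all_algebra.
From mathcomp Require Import all_classical all_reals all_analysis.

Set Implicit Arguments.
Unset Strict Implicit.
Unset Printing Implicit Defensive.

Import Order.TTheory GRing.Theory Num.Theory.
Local Open Scope classical_set_scope.
Local Open Scope ring_scope.

(* The measurable types of the library are pointed, hence so is the vocabulary;
   a distribution on V^T with T >= 1 exists only when V is inhabited. *)
#[short(type="finPointedType")]
HB.structure Definition FinPointed := {V of Finite V & Pointed V}.

(* V^T with its power set as sigma-algebra. *)
Definition text (V : finPointedType) (T : nat) : Type := T.-tuple V.

HB.instance Definition _ (V : finPointedType) (T : nat) :=
  Finite.copy (text V T) (T.-tuple V).
HB.instance Definition _ (V : finPointedType) (T : nat) :=
  isPointed.Build (text V T) (nseq_tuple T point).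
HB.instance Definition _ (V : finPointedType) (T : nat) :=
  @isMeasurable.Build default_measure_display (text V T) discrete_measurable
    discrete_measurable0 discrete_measurableC discrete_measurableU.

Section distributions.
Context {R : realType} {V : finPointedType} {T : nat}.
Local Notation dist := (probability (text V T) R).

Definition mass (P : dist) (x : text V T) : R := fine (P [set x]).

Definition excess (alpha : R) (P : dist) : R :=
  \sum_(x : text V T) Num.max (mass P x - alpha) 0.

Definition tv (P P' : dist) : R :=
  2^-1 * \sum_(x : text V T) `|mass P x - mass P' x|.

Definition distortion_function (D : dist -> dist -> R) : Prop :=
  (forall P P', 0 <= D P P') /\ (forall P, D P P = 0).

Definition excess_minimizer (D : dist -> dist -> R) (Q : dist)
    (alpha epsilon : R) (P : dist) : Prop :=
  D P Q <= epsilon /\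
  forall P', D P' Q <= epsilon -> excess alpha P <= excess alpha P'.

Lemma tv_distortion : distortion_function tv.
Proof.
split=> [P P'|P]; first by rewrite mulr_ge0 ?invr_ge0 ?sumr_ge0.
by rewrite /tv big1 ?mulr0// => x _; rewrite subrr normr0.
Qed.

End distributions.

HB.instance Definition _ d1 d2 (T1 : measurableType d1)
    (T2 : measurableType d2) :=
  isMeasurableFun.Build _ _ (T1 * T2)%type T1 fst measurable_fst.
HB.instance Definition _ d1 d2 (T1 : measurableType d1)
    (T2 : measurableType d2) :=
  isMeasurableFun.Build _ _ (T1 * T2)%type T2 snd measurable_snd.

Section schemes.
Context {R : realType} {V : finPointedType} {T : nat}.
Context {d : measure_display} {Z : measurableType d}.
Local Notation dist := (probability (text V T) R).
Local Notation scheme := (probability (text V T * T.-tuple Z)%type R).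
Local Notation detector := {mfun (text V T * T.-tuple Z)%type >-> bool}.

Definition text_marginal (P : scheme) : dist := distribution P fst.

Definition aux_marginal (P : scheme) : probability (T.-tuple Z) R :=
  distribution P snd.

Definition beta0 (gamma : detector) (Q' : dist)
    (Pzeta : probability (T.-tuple Z) R) : \bar R :=
  (Q' \x Pzeta)%E [set w | gamma w = true].

Definition beta1 (gamma : detector) (P : scheme) : \bar R :=
  P [set w | gamma w = false].

Definition admissible (D : dist -> dist -> R) (Q : dist) (alpha epsilon : R)
    (gamma : detector) (P : scheme) : Prop :=
  (ereal_sup [set beta0 gamma Q' (aux_marginal P) | Q' in [set: dist]]
     <= alpha%:E)%E /\
  D (text_marginal P) Q <= epsilon.

End schemes.

(* The infimum also ranges over the auxiliary alphabet Z, an arbitrary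
   measurable space, since its choice is part of the design. *)
Definition beta1_star (R : realType) (V : finPointedType) (T : nat)
    (D : probability (text V T) R -> probability (text V T) R -> R)
    (Q : probability (text V T) R) (alpha epsilon : R) : \bar R :=
  ereal_inf [set b | exists (d : measure_display) (Z : measurableType d)
    (gamma : {mfun (text V T * T.-tuple Z)%type >-> bool})
    (P : probability (text V T * T.-tuple Z)%type R),
    admissible D Q alpha epsilon gamma P /\ b = beta1 gamma P].

(* Main.v *)
(* Testing the Type-I constraint on point masses bounds the section
   [zeta : gamma (x, zeta) = 1] by alpha for every x, so that a scheme with text
   marginal P detects at most min(P x, alpha) at x; hence the Type-II error is
   at least sum_x (P x - alpha)_+.  Conversely, draw x from P and let zeta be a
   copy of x flagged with probability min(1, alpha / P x); the detector that
   accepts when zeta is a flagged copy of the text attains the bound.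
   For total variation, (P x - alpha)_+ + (Q x - P x)_+ >= (Q x - alpha)_+ gives
   the lower bound, and moving mass min(epsilon, sum (Q - alpha)_+) from the
   texts above alpha to those below alpha attains it. *)
Require Import Defs.
From HB Require Import structures.
From mathcomp Require Import all_boot all_order all_algebra.
From mathcomp Require Import all_classical all_reals all_analysis.
From mathcomp Require Import lra.

Set Implicit Arguments.
Unset Strict Implicit.
Unset Printing Implicit Defensive.

Import Order.TTheory GRing.Theory Num.Theory.
Local Open Scope classical_set_scope.
Local Open Scope ring_scope.

(** * Probability measures: extensionality, finite mixtures, fibers *)

(** Besides its underlying function a packed probability holds only proofs, which proof irrelevance
    identifies. *)
Lemma eq_probability d (Y : measurableType d) (R : realType)
    (P1 P2 : probability Y R) :
  (P1 : set Y -> \bar R) = P2 -> P1 = P2.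
Proof.
case: P1 P2 => f1 c1 [f2 c2] /= e.
case: f2 / e c2 => c2; congr Probability.Pack.
case: c1 c2 => [[a1 b1] [s1] [t1] [u1] [v1] [w1] [x1]].
case=> [[a2 b2] [s2] [t2] [u2] [v2] [w2] [x2]].
have ea : a1 = a2 by exact: Prop_irrelevance.
case: a2 / ea b2 s2 => b2 s2.
have eb : b1 = b2 by exact: Prop_irrelevance.
case: b2 / eb s2 => s2.
by congr Probability.Class; f_equal; exact: Prop_irrelevance.
Qed.

Lemma finite_mixture_exists d (Y : measurableType d) (R : realType)
    (I : finType) (p : I -> R) (w : I -> Y) :
  (forall i, 0 <= p i) -> \sum_i p i = 1 ->
  exists P : probability Y R,
    forall A, P A = (\sum_i p i * (w i \in A)%:R)%:E.
Proof.
move=> p_ge0 p_sum1.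
have [mu muE] : exists mu : {measure set Y -> \bar R},
    forall A, mu A = (\sum_i p i * (w i \in A)%:R)%:E.
  elim: (index_enum I) => [|i s [mu IH]].
    by exists mzero => A; rewrite big_nil.
  exists (measure_add (mscale (NngNum (p_ge0 i)) \d_(w i)) mu) => A.
  rewrite [LHS]measure_addE IH big_cons /mscale /=.
  by rewrite EFinD EFinM; congr (_ * _ + _)%E.
have mu1 : mu setT = 1%E.
  rewrite muE; congr EFin; rewrite -[RHS]p_sum1.
  by apply: eq_bigr => i _; rewrite mem_set// mulr1.
(* The total mass is already 1, so normalizing leaves [mu] unchanged and only packs it as a
   probability; the Dirac mass is the default for a degenerate measure. *)
exists (mnormalize mu \d_(point : Y)) => A.
by rewrite /= /mnormalize /= mu1 /= onee_eq0 /= invr1 mule1 muE.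
Qed.

Lemma measure_fibers d (Y : measurableType d) (R : realType)
    (mu : {measure set Y -> \bar R}) (I : finType) (f : Y -> I) (B : set Y) :
  (forall x, measurable (f @^-1` [set x])) -> measurable B ->
  mu B = (\sum_x mu (B `&` f @^-1` [set x]))%E.
Proof.
move=> mf mB.
have -> : mu B = mu (\bigcup_(x in [set: I]) (B `&` f @^-1` [set x])).
  congr (mu _); apply/seteqP; split=> [y By|y [x _ []]//].
  by exists (f y).
rewrite measure_fin_bigcup//.
- rewrite [RHS]fsbig_seq ?index_enum_uniq//.
  suff -> : [set` index_enum I] = [set: I] by [].
  by apply/seteqP; split=> // x _ /=; rewrite mem_index_enum.
- exact: finite_finset.
- apply/trivIsetP => x y _ _ xy; apply/seteqP; split=> // z [[_ /= zx] [_ zy]].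
  by move: xy; rewrite -zx zy eqxx.
- by move=> x _; exact: measurableI.
Qed.

(** * Text distributions as mass functions *)

Section Text.
Context {R : realType} {V : finPointedType} {T : nat}.
Local Notation dist := (probability (text V T) R).

Lemma mass_ge0 (P : dist) x : 0 <= mass P x.
Proof. by rewrite fine_ge0. Qed.

Lemma massE (P : dist) x : P [set x] = (mass P x)%:E.
Proof. by rewrite fineK// fin_num_measure. Qed.

Lemma text_measureE (P : dist) A :
  P A = (\sum_(x : text V T) mass P x * (x \in A)%:R)%:E.
Proof.
rewrite (measure_fibers P (f := id))// -sumEFin; apply: eq_bigr => x _.
have [/set_mem Ax|/negP nAx] := boolP (x \in A).
  rewrite mulr1 -massE; congr (P _).
  by apply/seteqP; split=> [y []//|y /= ->].
rewrite mulr0 -[RHS](measure0 P); congr (P _).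
by apply/seteqP; split=> // y [Ay /= yx]; apply: nAx; rewrite -yx mem_set.
Qed.

Lemma sum_mass (P : dist) : \sum_(x : text V T) mass P x = 1.
Proof.
apply: EFin_inj; rewrite -(probability_setT P) text_measureE; congr EFin.
by apply: eq_bigr => x _; rewrite mem_set// mulr1.
Qed.

Lemma mass_inj (P P' : dist) : mass P =1 mass P' -> P = P'.
Proof.
move=> PP'; apply: eq_probability; apply/funext => A.
by rewrite !text_measureE; congr EFin; apply: eq_bigr => x _; rewrite PP'.
Qed.

Lemma dist_of_mass_exists (p : text V T -> R) :
  (forall x, 0 <= p x) -> \sum_x p x = 1 -> exists P : dist, mass P =1 p.
Proof.
move=> p_ge0 p1.
have [P PE] := finite_mixture_exists (id : text V T -> text V T) p_ge0 p1.
exists P => x; rewrite /mass PE /= (bigD1 x)//= mem_set// mulr1 big1 ?addr0//.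
by move=> y yx; rewrite memNset ?mulr0//= => /eqP; exact/negP.
Qed.

End Text.

(** * Lower bound on the Type-II error *)

Section Converse.
Context {R : realType} {V : finPointedType} {T : nat}.
Context {d : measure_display} {Z : measurableType d}.
Local Notation dist := (probability (text V T) R).
Local Notation scheme := (probability (text V T * T.-tuple Z)%type R).
Local Notation detector := {mfun (text V T * T.-tuple Z)%type >-> bool}.

Lemma measurable_detector (gamma : detector) b :
  measurable [set w | gamma w = b].
Proof. exact: (@measurable_funPTI _ _ _ _ gamma [set b]). Qed.

Lemma xsection_detector (gamma : detector) (x : text V T) :
  xsection [set w | gamma w = true] x = [set z | gamma (x, z) = true].
Proof. by apply/seteqP; split=> z; rewrite /xsection /= in_setE. Qed.

Lemma beta0_dirac (gamma : detector) (x : text V T)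
    (Pzeta : probability (T.-tuple Z) R) :
  beta0 gamma \d_x Pzeta = Pzeta [set z | gamma (x, z) = true].
Proof.
rewrite /beta0 /product_measure1 integral_dirac//.
by rewrite diracE mem_set// mul1e /= xsection_detector.
Qed.

Lemma beta0_le_sup (gamma : detector) (alpha : R)
    (Pzeta : probability (T.-tuple Z) R) (x : text V T) :
  (ereal_sup [set beta0 gamma Q' Pzeta | Q' in [set: dist]] <= alpha%:E)%E ->
  (Pzeta [set z | gamma (x, z) = true] <= alpha%:E)%E.
Proof.
move=> h; rewrite -beta0_dirac; apply: le_trans h.
by apply: ereal_sup_ubound; exists (\d_x).
Qed.

(** The Type-I error is the average under [Q] of the section probabilities, so a uniform bound on
    these carries over. *)
Lemma beta0_le (gamma : detector)
    (Pzeta : probability (T.-tuple Z) R) (alpha : R) (Q : dist) :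
  (forall x, (Pzeta [set z | gamma (x, z) = true] <= alpha%:E)%E) ->
  (beta0 gamma Q Pzeta <= alpha%:E)%E.
Proof.
move=> h; rewrite /beta0 /product_measure1.
have -> : alpha%:E = (\int[Q]_x cst alpha%:E x)%E.
  rewrite integral_cst // [X in (_ * X)%E](_ : _ = 1%E) ?mule1//.
  exact: probability_setT.
apply: (@ge0_le_integral _ (text V T) R Q setT measurableT) => //= x _.
by rewrite xsection_detector.
Qed.

Lemma excess_le_beta1 (D : dist -> dist -> R) (Q : dist) (alpha epsilon : R)
    (gamma : detector) (P : scheme) :
  admissible D Q alpha epsilon gamma P ->
  ((excess alpha (text_marginal P))%:E <= beta1 gamma P)%E.
Proof.
move=> [h _]; rewrite /beta1 (measure_fibers P (f := fst)); last first.
- exact: measurable_detector.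
- by move=> x; rewrite -[X in measurable X]setTI; exact: measurable_fst.
rewrite /excess -sumEFin; apply: lee_sum => x _.
have mx : measurable (fst @^-1` [set x] : set (text V T * T.-tuple Z)).
  by rewrite -[X in measurable X]setTI; exact: measurable_fst.
rewrite EFin_max ge_max measure_ge0 andbT.
rewrite EFinB -massE leeBlDr//.
have -> : text_marginal P [set x] = P (fst @^-1` [set x]) by [].
(* Split the fiber over [x] by the verdict: the rejected part is the term of the Type-II error, and
   the accepted part must be at most [alpha]. *)
rewrite (measure_fibers P (I := bool) (f := gamma)
  (B := fst @^-1` [set x])) //; last first.
  by move=> b; exact: measurable_detector.
rewrite big_bool /= addeC; apply: leeD.
  by rewrite setIC.
(* Forgetting the text enlarges the accepted part to an event on zeta alone, whose probability is
   read off the auxiliary marginal. *)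
apply: le_trans (beta0_le_sup x h).
apply: le_measure; rewrite ?inE.
- by apply: measurableI => //; exact: measurable_detector.
- rewrite -[X in measurable X]setTI.
  apply: measurable_snd => //.
  rewrite -xsection_detector.
  by apply: measurable_xsection; exact: measurable_detector.
- by move=> [y z] [/= -> ].
Qed.

End Converse.

(** * A scheme and detector attaining the bound *)

Section Coupling.
Context {R : realType} {V : finPointedType} {T : nat} (i0 : 'I_T).
Local Notation dist := (probability (text V T) R).
Local Notation aux := (text V T * bool)%type.

(* A letter (x, true) of the auxiliary alphabet vouches for x, and a letter with
   flag false vouches for nothing.  The auxiliary sequences in use are constant,
   so a single position i0 is inspected. *)
Definition matching_detector (w : text V T * T.-tuple aux) : bool :=
  tnth w.2 i0 == (w.1, true).

Lemma measurable_matching_detector : measurable_fun setT matching_detector.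
Proof.
apply: (measurable_fun_bool true).
(* The acceptance region is a finite union of rectangles, one for each text. *)
have -> : [set: text V T * T.-tuple aux] `&` matching_detector @^-1` [set true] =
    \bigcup_(x in [set: text V T])
      ([set x] `*` ((fun z : T.-tuple aux => tnth z i0) @^-1` [set (x, true)])).
  apply/seteqP; split=> [[x z] [_ /eqP /= e]|[x z] [y _ [/= -> e]]].
    by exists x.
  by split=> //; apply/eqP.
apply: fin_bigcup_measurable => [|x _]; first exact: finite_finset.
apply: measurableX => //.
rewrite -[X in measurable X]setTI; apply: measurable_tnth => //.
have -> : [set (x, true)] = [set x] `*` [set true] by
  apply/seteqP; split=> [[y b] [-> ->]|[y b] [/= -> ->]].
exact: measurableX.
Qed.

HB.instance Definition _ := isMeasurableFun.Build _ _ _ _ matching_detector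
  measurable_matching_detector.

(** Joint law of the text and its flag; the weight [Num.min (mass P x) alpha] is P x times the
    flagging probability min(1, alpha / P x), written without division. *)
Definition label_weight (alpha : R) (P : dist) (i : aux) : R :=
  if i.2 then Num.min (mass P i.1) alpha else Num.max (mass P i.1 - alpha) 0.

Lemma label_weight_ge0 alpha P i : 0 <= alpha -> 0 <= label_weight alpha P i.
Proof.
move=> a0; rewrite /label_weight; case: ifP => _.
  by rewrite le_min mass_ge0.
by rewrite le_max lexx orbT.
Qed.

Lemma label_weight_split alpha P x :
  label_weight alpha P (x, true) + label_weight alpha P (x, false) = mass P x.
Proof.
rewrite /label_weight /=; case: (leP (mass P x) alpha) => h.
  by rewrite max_r ?subr_le0// addr0.
by rewrite max_l ?subr_ge0 ?ltW// addrC subrK.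
Qed.

Lemma sum_text_label (F : aux -> R) :
  \sum_i F i = \sum_x (F (x, true) + F (x, false)).
Proof.
rewrite (eq_bigr (fun i => F (i.1, i.2))); last by case.
rewrite -(pair_bigA _ (fun x b => F (x, b))) /=; apply: eq_bigr => x _.
by rewrite big_bool.
Qed.

(** [S] draws a letter [i] by [label_weight] and emits the text [i.1] with the constant sequence
    [i]. Text and letter then always agree, so rejection means flag false, while a fixed text [x] is
    accepted only against the letter [(x, true)]. *)
Lemma matching_scheme_exists (alpha : R) (P : dist) : 0 <= alpha ->
  exists S : probability (text V T * T.-tuple aux)%type R,
    [/\ text_marginal S = P,
        forall x, aux_marginal S [set z | matching_detector (x, z) = true] =
          (Num.min (mass P x) alpha)%:E &
        beta1 matching_detector S = (excess alpha P)%:E].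
Proof.
move=> a0.
have [|S SE] := finite_mixture_exists
    (fun i : aux => (i.1, nseq_tuple T i) : (text V T * T.-tuple aux)%type)
    (fun i => label_weight_ge0 P i a0).
  rewrite sum_text_label -(sum_mass P); apply: eq_bigr => x _.
  exact: label_weight_split.
have detE x y b : matching_detector (x, nseq_tuple T (y, b)) = ((y, b) == (x, true)).
  by rewrite /matching_detector /= tnth_nseq.
exists S; split.
- apply: mass_inj => x.
  rewrite /mass [text_marginal S _]SE /= sum_text_label (bigD1 x)//=.
  rewrite !mem_set// !mulr1 label_weight_split big1 ?addr0// => y /eqP yx.
  by rewrite !memNset// !mulr0 addr0.
- move=> x; rewrite [aux_marginal S _]SE /= sum_text_label; congr EFin.
  rewrite (bigD1 x)//= mem_set ?memNset /= ?detE ?eqxx ?xpair_eqE ?andbF//.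
  rewrite mulr1 mulr0 addr0 big1 ?addr0// => y /eqP yx.
  by rewrite !memNset /= ?detE ?mulr0 ?addr0// => /eqP[].
- rewrite /beta1 [LHS]SE sum_text_label; congr EFin; apply: eq_bigr => x _.
  rewrite memNset ?mem_set /= ?detE ?eqxx ?xpair_eqE ?andbF//.
  by rewrite mulr1 mulr0 add0r.
Qed.

End Coupling.

(** * Excess under a total variation constraint *)

Section TotalVariation.
Context {R : realType} {V : finPointedType} {T : nat}.
Local Notation dist := (probability (text V T) R).
Implicit Types P Q : dist.

Lemma excess_ge0 (alpha : R) P : 0 <= excess alpha P.
Proof. by apply: sumr_ge0 => x _; rewrite le_max lexx orbT. Qed.

Lemma tvE P Q : tv P Q = \sum_(x : text V T) Num.max (mass Q x - mass P x) 0.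
Proof.
have s0 : \sum_(x : text V T) (mass Q x - mass P x) = 0.
  by rewrite big_split /= sumrN !sum_mass subrr.
(* Termwise |t|/2 = t_+ - t/2, and the linear parts cancel because both masses sum to 1. *)
transitivity (\sum_(x : text V T)
    (Num.max (mass Q x - mass P x) 0 - 2^-1 * (mass Q x - mass P x))).
  rewrite /tv mulr_sumr; apply: eq_bigr => x _.
  case: (leP (mass Q x) (mass P x)) => h.
    by rewrite max_r ?subr_le0// ger0_norm ?subr_ge0//; lra.
  by rewrite max_l ?subr_ge0 ?ltW// ltr0_norm ?subr_lt0//; lra.
by rewrite big_split /= sumrN -mulr_sumr s0 mulr0 subr0.
Qed.

Lemma excess_sub_le_tv (alpha : R) P Q : excess alpha Q - tv P Q <= excess alpha P.
Proof.
rewrite tvE lerBlDr /excess -big_split /=; apply: ler_sum => x _.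
rewrite ge_max; apply/andP; split.
  have : mass Q x - mass P x <= Num.max (mass Q x - mass P x) 0.
    by rewrite le_max lexx.
  have : mass P x - alpha <= Num.max (mass P x - alpha) 0.
    by rewrite le_max lexx.
  by lra.
by rewrite addr_ge0// le_max lexx orbT.
Qed.

Lemma tv_excess_attained (alpha epsilon : R) Q :
  0 <= alpha -> 0 <= epsilon ->
  epsilon <= \sum_(x : text V T) Num.max (alpha - mass Q x) 0 ->
  exists P, tv P Q <= epsilon /\
    excess alpha P = Num.max (excess alpha Q - epsilon) 0.
Proof.
move=> a0 e0; set F := (\sum_x _ in X in X -> _) => eF.
pose E := excess alpha Q; have E0 : 0 <= E := excess_ge0 alpha Q.
pose delta := Num.min epsilon E.
have d0 : 0 <= delta by rewrite le_min e0.
have dE : delta <= E by rewrite ge_min lexx orbT.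
have de : delta <= epsilon by rewrite ge_min lexx.
have dF : delta <= F := le_trans de eF.
(* P moves the amount delta of mass from the texts above alpha to those below,
   proportionally to the excesses and to the deficits; the quotients are 0 when
   E or F vanishes, where nothing has to be moved. *)
pose a := delta / E; pose b := delta / F.
have frac (S : R) : delta <= S -> [/\ 0 <= delta / S, delta / S <= 1 & delta / S * S = delta].
  move=> dS; have [S0|S0] := eqVneq S 0.
    rewrite S0 invr0 mulr0 ler01 lexx; split=> //; apply/eqP.
    by rewrite mulr0 eq_sym eq_le d0 andbT -S0.
  have Sgt0 : 0 < S by rewrite lt_neqAle eq_sym S0 (le_trans d0).
  split; [exact: divr_ge0 (ltW Sgt0)|by rewrite ler_pdivrMr ?mul1r|].
  by rewrite divfK.
have [a_ge0 a_le1 aE] := frac E dE; have [b_ge0 b_le1 bF] := frac F dF.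
rewrite -/a in a_ge0 a_le1 aE; rewrite -/b in b_ge0 b_le1 bF.
pose up x := Num.max (alpha - mass Q x) 0.
pose dn x := Num.max (mass Q x - alpha) 0.
have [x||P PE] := @dist_of_mass_exists R V T
    (fun x => mass Q x - a * dn x + b * up x).
(* Since [a <= 1], a text above [alpha] keeps at least mass [alpha]; the others only gain. *)
- have := mass_ge0 Q x; rewrite /up /dn.
  case: (leP (mass Q x) alpha) => h.
    by rewrite (max_r (_ : mass Q x - alpha <= 0)) ?(max_l (_ : 0 <= alpha - mass Q x)); nra.
  by rewrite max_l ?(max_r (_ : alpha - mass Q x <= 0)); nra.
- by rewrite !big_split /= sumrN -!mulr_sumr sum_mass aE bF subrK.
exists P; split.
  rewrite tvE; apply: le_trans de; rewrite -aE /E /excess mulr_sumr.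
  apply: ler_sum => x _; rewrite PE ge_max.
  have dn0 : 0 <= dn x by rewrite le_max lexx orbT.
  have up0 : 0 <= up x by rewrite le_max lexx orbT.
  by apply/andP; split; rewrite -/(dn x); nra.
transitivity (E - delta); last first.
  rewrite /delta; case: (leP epsilon E) => h; first by rewrite max_l ?subr_ge0.
  by rewrite subrr max_r// subr_le0 ltW.
(* Each excess shrinks by the factor [1 - a]; since [b <= 1], no text below [alpha] is lifted above
   it, so no new excess appears. *)
rewrite -aE -{1}[E]mul1r -mulrBl /E /excess mulr_sumr; apply: eq_bigr => x _.
rewrite PE /up /dn; case: (leP (mass Q x) alpha) => h.
  rewrite (max_r (_ : mass Q x - alpha <= 0)) ?subr_le0//.
  rewrite (max_l (_ : 0 <= alpha - mass Q x)) ?subr_ge0// !mulr0 max_r ?mulr0//; nra.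
rewrite (max_l (_ : 0 <= mass Q x - alpha)) ?subr_ge0 ?ltW//.
rewrite (max_r (_ : alpha - mass Q x <= 0)) ?subr_le0 ?ltW// max_l; last by nra.
by lra.
Qed.

End TotalVariation.

(** * The optimal value *)

Section Optimum.
Context {R : realType} {V : finPointedType} {T : nat}.
Local Notation dist := (probability (text V T) R).

Lemma excess_attained (D : dist -> dist -> R) (Q P : dist) (alpha epsilon : R) :
  (1 <= T)%N -> 0 <= alpha -> D P Q <= epsilon ->
  exists (d : measure_display) (Z : measurableType d)
    (gamma : {mfun (text V T * T.-tuple Z)%type >-> bool})
    (S : probability (text V T * T.-tuple Z)%type R),
    [/\ admissible D Q alpha epsilon gamma S, text_marginal S = P &
        beta1 gamma S = (excess alpha P)%:E].
Proof.
move=> T1 a0 DPQ; pose i0 := Ordinal T1.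
have [S [SP Saux Sbeta]] := matching_scheme_exists i0 P a0.
exists _, (text V T * bool)%type, (matching_detector i0), S; split=> //.
split; last by rewrite SP.
apply: ge_ereal_sup => _ [Q' _ <-]; apply: beta0_le => x.
by rewrite [leLHS]Saux lee_fin ge_min lexx orbT.
Qed.

Lemma beta1_starE (D : dist -> dist -> R) (Q P : dist) (alpha epsilon : R) :
  (1 <= T)%N -> 0 <= alpha -> excess_minimizer D Q alpha epsilon P ->
  beta1_star D Q alpha epsilon = (excess alpha P)%:E.
Proof.
move=> T1 a0 [DPQ Pmin]; apply/eqP; rewrite eq_le; apply/andP; split.
  have [d [Z [gamma [S [adm _ <-]]]]] := excess_attained T1 a0 DPQ.
  by apply: ereal_inf_lbound; exists d, Z, gamma, S.
apply: le_ereal_inf_tmp => _ [d [Z [gamma [S [adm ->]]]]].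
(* The text marginal of an admissible scheme is itself feasible, so its excess is at least the
   minimum. *)
apply: le_trans (excess_le_beta1 adm); rewrite lee_fin.
by apply: Pmin; case: adm.
Qed.

End Optimum.

Theorem theorem1 (R : realType) (V : finPointedType) (T : nat)
    (T_ge1 : (1 <= T)%N) (Q : probability (text V T) R)
    (alpha epsilon : R) (alpha_gt0 : 0 < alpha) (alpha_lt1 : alpha < 1)
    (epsilon_ge0 : 0 <= epsilon) :
  (forall D : probability (text V T) R -> probability (text V T) R -> R,
     distortion_function D ->
     (exists P, excess_minimizer D Q alpha epsilon P) ->
     (exists2 Pmin : probability (text V T) R,
        excess_minimizer D Q alpha epsilon Pmin &
        beta1_star D Q alpha epsilon =
          (\sum_(x : text V T) Num.max (mass Pmin x - alpha) 0)%:E) /\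
     (forall Pstar : probability (text V T) R,
        excess_minimizer D Q alpha epsilon Pstar ->
        exists (d : measure_display) (Z : measurableType d)
          (gamma : {mfun (text V T * T.-tuple Z)%type >-> bool})
          (P : probability (text V T * T.-tuple Z)%type R),
          [/\ admissible D Q alpha epsilon gamma P,
              text_marginal P = Pstar &
              beta1 gamma P = beta1_star D Q alpha epsilon])) /\
  (epsilon <= \sum_(x : text V T) Num.max (alpha - mass Q x) 0 ->
   beta1_star tv Q alpha epsilon =
     (Num.max (\sum_(x : text V T) Num.max (mass Q x - alpha) 0 - epsilon)
        0)%:E).
Proof.
have alpha_ge0 := ltW alpha_gt0.
split=> [D _ [Pmin minPmin]|epsilon_le].
  split=> [|Pstar minPstar].
    by exists Pmin => //; exact: beta1_starE minPmin.
  rewrite (beta1_starE T_ge1 alpha_ge0 minPstar).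
  by apply: excess_attained => //; case: minPstar.
have [P [tvP excessP]] := tv_excess_attained alpha_ge0 epsilon_ge0 epsilon_le.
(* [P] is a minimizer: any feasible [P'] has excess at least that of [Q] minus [epsilon], and at
   least 0. *)
rewrite (@beta1_starE _ _ _ tv Q P) ?excessP//; split=> // P' tvP'.
rewrite excessP ge_max excess_ge0 andbT.
apply: le_trans (excess_sub_le_tv alpha P' Q).
by rewrite lerD2l lerN2.
Qed.
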